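(* Let $G$ be a balanced bipartite graph of order $2n$. If $q(\widehat{G})\leq n$, then $G$ is Hamiltonian unless $G\in\bigcup_{k=1}^{\lfloor n/2\rfloor}\mathcal{B}_n^k$, or $G=\varGamma_1$ or $\varGamma_2$ for $n=4$.
   Context: All graphs are finite and simple; equality of graphs and membership in classes of graphs are up to isomorphism. $q(G)$ is the signless Laplacian spectral radius, i.e. the largest eigenvalue of $A+D$, where $A$ is the adjacency matrix and $D$ the diagonal degree matrix of $G$. A graph is Hamiltonian if it contains a cycle through all its vertices. A bipartite graph with partite sets $X,Y$ is balanced if $|X|=|Y|$. The quasi-complement $\widehat{G}$ of a bipartite graph $G$ with partite sets $X,Y$ is the graph on the same vertex set (bipartite with the same partite sets) in which, for $x\in X$, $y\in Y$, $xy\in E(\widehat{G})$ if and only if $xy\notin E(G)$. For $1\leq k\leq n/2$, $\mathcal{B}_n^k$ is the set of balanced bipartite graphs of order $2n$ obtained from some bipartite graph $H$ with partite sets $X_0,Y_0$ of sizes $k$ and $n-k$, respectively, by adding $k$ additional vertices, each adjacent exactly to all vertices of $X_0$, and $n-k$ additional vertices, each adjacent exactly to all vertices of $Y_0$. $\varGamma_1$ is the bipartite graph with partite sets $\{t_1,t_2,t_3,t_4\}$ and $\{b_1,b_2,b_3,b_4\}$ and edge set $\{t_ib_i,\ t_1b_i,\ t_ib_1 : i=2,3,4\}$. $\varGamma_2$ is $\varGamma_1$ with the additional edge $t_1b_1$.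
   Formalization: The formal theorem assumes n ≥ 2: for n = 1 the graph K_2 has q of its quasi-complement equal to 0 ≤ 1, yet it is not Hamiltonian and not among the exceptions (for n = 0 the radius is undefined). *)

(* Defs.v *)
From mathcomp Require Import all_boot all_order all_algebra polyrcf complex reals.

Set Implicit Arguments.
Unset Strict Implicit.
Unset Printing Implicit Defensive.

Import Order.TTheory GRing.Theory Num.Theory.

Local Open Scope ring_scope.

Definition simple_graph (T : finType) (e : rel T) : Prop :=
  symmetric e /\ irreflexive e.

Definition graph_iso (T U : finType) (e : rel T) (f : rel U) : Prop :=
  exists2 phi : T -> U, bijective phi & forall x y, f (phi x) (phi y) = e x y.

(* A cycle of a simple graph has length at least 3; the bound on [size c]
   rules out [:: x; y] with x, y adjacent, which path.v counts as a cycle. *)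
Definition hamiltonian (T : finType) (e : rel T) : Prop :=
  exists c : seq T,
    [/\ (2 < size c)%N, ucycle e c & forall x, x \in c].

Definition has_partite_sets (T : finType) (e : rel T) (X Y : {set T}) : Prop :=
  [/\ X :|: Y = [set: T], [disjoint X & Y] &
      forall x y, e x y ->
        (x \in X) && (y \in Y) || (x \in Y) && (y \in X)].

(* The quasi-complement depends on the partite sets, not only on the graph,
   as soon as the graph is disconnected. *)
Definition quasi_complement (T : finType) (X Y : {set T}) (e : rel T) : rel T :=
  fun x y =>
    ((x \in X) && (y \in Y) || (x \in Y) && (y \in X)) && ~~ e x y.

Definition adjacency_mx (R : nzRingType) (T : finType) (e : rel T)
    : 'M[R]_#|T| :=
  \matrix_(i, j) (e (enum_val i) (enum_val j))%:R.

Definition degree (T : finType) (e : rel T) (x : T) : nat :=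
  #|[set y | e x y]|.

Definition degree_mx (R : nzRingType) (T : finType) (e : rel T)
    : 'M[R]_#|T| :=
  diag_mx (\row_i (degree e (enum_val i))%:R).

Definition signless_laplacian (R : nzRingType) (T : finType) (e : rel T)
    : 'M[R]_#|T| :=
  adjacency_mx R e + degree_mx R e.

Definition largest_eigenvalue (R : realFieldType) (n : nat) (M : 'M[R]_n)
    (q : R) : Prop :=
  eigenvalue M q /\ forall a, eigenvalue M a -> a <= q.

(* [signless_radius e q] reads q(G) = q; such a q exists, see
   [signless_radius_exists], and is clearly unique. *)
Definition signless_radius (R : realFieldType) (T : finType) (e : rel T)
    (q : R) : Prop :=
  largest_eigenvalue (signless_laplacian R e) q.

Lemma symmetric_has_largest_eigenvalue (R : rcfType) (n : nat) (M : 'M[R]_n) :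
  (0 < n)%N -> M^T = M -> exists q, largest_eigenvalue M q.
Proof.
move=> n_gt0 M_sym.
have [a Ma] : exists a, eigenvalue M a.
  pose N := map_mx (real_complex R) M.
  have N_herm : N \is hermsymmx.
    apply/is_hermitianmxP; rewrite expr0 scale1r.
    apply/matrixP=> i j; rewrite !mxE -[in LHS]M_sym mxE.
    by apply/esym/CrealP; rewrite complex_real.
  have /hermitian_normalmx/orthomx_spectralP N_eq := N_herm.
  have /mxOverP/(_ ord0 (Ordinal n_gt0))/complex_realP[a def_a] :=
    hermitian_spectral_diag_real N_herm.
  exists a; rewrite -(eigenvalue_map (real_complex R)) -/N.
  set P := spectralmx N in N_eq; set D := spectral_diag N in N_eq def_a.
  have P_unit : P \in unitmx by exact: spectral_unit.
  apply/eigenvalueP; exists (row (Ordinal n_gt0) P).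
    rewrite -row_mul {1}N_eq !mulmxA mulmxV // mul1mx.
    by apply/rowP=> j; rewrite !mxE (bigD1 (Ordinal n_gt0)) //= big1 ?addr0;
       [rewrite !mxE eqxx mulr1n def_a
       | move=> k /negPf k_neq; rewrite !mxE eq_sym k_neq mulr0n mul0r].
  apply/eqP=> /(congr1 (mulmx^~ (invmx P))) /=.
  rewrite -row_mul mulmxV // mul0mx => /rowP/(_ (Ordinal n_gt0))/eqP.
  by rewrite !mxE eqxx oner_eq0.
have p_neq0 : char_poly M != 0 by exact/monic_neq0/char_poly_monic.
pose s := rootsR (char_poly M).
have sE x : eigenvalue M x = (x \in s).
  by rewrite eigenvalue_root_char -(roots_on_rootsR p_neq0).
exists (\big[Num.max/a]_(x <- s) x); split; last first.
  by move=> x; rewrite sE => xs; apply: le_bigmax_seq.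
rewrite big_seq; elim/big_ind: _ => //= [x y Mx My|x]; last by rewrite sE.
by rewrite maxEle; case: ifP.
Qed.

Lemma signless_radius_exists (R : rcfType) (T : finType) (e : rel T) :
  (0 < #|T|)%N -> simple_graph e -> exists q : R, signless_radius e q.
Proof.
move=> T_gt0 [e_sym _]; apply: symmetric_has_largest_eigenvalue => //.
rewrite linearD /= tr_diag_mx; congr (_ + _).
by apply/matrixP=> i j; rewrite !mxE e_sym.
Qed.

(* The graph obtained from (T, h) by adding k vertices adjacent exactly to X0
   and l vertices adjacent exactly to Y0. *)
Definition add_twins (T : finType) (h : rel T) (X0 Y0 : {set T}) (k l : nat)
    : rel (T + ('I_k + 'I_l)) :=
  fun u v =>
    match u, v with
    | inl x, inl y => h x y
    | inl x, inr (inl _) | inr (inl _), inl x => x \in X0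
    | inl x, inr (inr _) | inr (inr _), inl x => x \in Y0
    | inr _, inr _ => false
    end.

(* Membership in B_n^k, up to isomorphism. *)
Definition in_B (n k : nat) (T : finType) (e : rel T) : Prop :=
  exists (T0 : finType) (h : rel T0) (X0 Y0 : {set T0}),
    [/\ simple_graph h, has_partite_sets h X0 Y0,
        #|X0| = k, #|Y0| = (n - k)%N &
        graph_iso e (@add_twins T0 h X0 Y0 k (n - k))].

Definition bipartite_rel (A B : finType) (r : A -> B -> bool) : rel (A + B) :=
  fun u v =>
    match u, v with
    | inl a, inr b | inr b, inl a => r a b
    | _, _ => false
    end.

(* [inl i] is t_(i+1) and [inr j] is b_(j+1). *)
Definition Gamma1 : rel ('I_4 + 'I_4) :=
  bipartite_rel (fun i j : 'I_4 =>
    [|| (0 < i)%N && (j == i), (i == ord0) && (0 < j)%N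
      | (0 < i)%N && (j == ord0)]).

Definition Gamma2 : rel ('I_4 + 'I_4) :=
  fun u v =>
    [|| Gamma1 u v, (u == inl ord0) && (v == inr ord0)
      | (u == inr ord0) && (v == inl ord0)].

(* Main.v *)
Require Import Defs.
From mathcomp Require Import all_boot all_order all_algebra reals.
From mathcomp Require Import complex ring zify.
Import Order.TTheory GRing.Theory Num.Theory.
Local Open Scope ring_scope.
Set Implicit Arguments.
Unset Strict Implicit.
Unset Printing Implicit Defensive.

(** Let [h] be an edge-maximal non-Hamiltonian bipartite supergraph of [e].
    Nonadjacent vertices on opposite sides are then joined by a Hamiltonian path
    of [h], so their degrees sum to at most [n]; that is, on every edge of the
    quasi-complement of [h] the degrees (in that quasi-complement) sum to at
    least [n].  Testing the Rayleigh quotient of the quasi-complement of [e] on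
    the degree vector of the quasi-complement of [h], the bound [q <= n] forces
    equality: all these sums are exactly [n], and [e] and [h] differ only in
    edges joining two vertices of full degree in [h].

    Let [x_0 y_0 x_1 y_1 ... x_(n-1) y_(n-1)] be a Hamiltonian path and let
    [w i] say that [x_0 y_i] is an edge.  Equality makes [x_i y_(n-1)] an edge
    iff [w i] fails.  If [w i], reversing the prefix [x_0 ... x_i] gives another
    Hamiltonian path, whose word is that of the first with a prefix reversed;
    hence [w] determines all neighbours of the [x_i] with [w i] and of the [y_i]
    without.  Comparing both descriptions, over all the reversed paths, leaves
    only the words [1^s 0^(n-s)], which give [B_n^s], and [(10)^m], which is
    impossible for [m > 2] and gives [Gamma1] or [Gamma2] for [m = 2]. *)

(** * Rayleigh quotients and the signless Laplacian *)

(** In an orthonormal eigenbasis of the complexified matrix, both sides become sums of the squared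
    moduli of the coordinates of [z], weighted by the eigenvalues on the left and by [q] on the
    right. *)
Lemma rayleigh_le (R : rcfType) (m : nat) (M : 'M[R]_m) (q : R) :
  M^T = M -> (forall a, eigenvalue M a -> a <= q) ->
  forall z : 'rV_m, (z *m M *m z^T) 0 0 <= q * (z *m z^T) 0 0.
Proof.
move=> M_sym Mq z; pose f := real_complex R; pose N := map_mx f M.
have fC m1 m2 (A : 'M[R]_(m1, m2)) : map_mx Num.conj (map_mx f A) = map_mx f A.
  by apply/matrixP=> i j; rewrite !mxE; apply/CrealP; rewrite complex_real.
have N_herm : N \is hermsymmx.
  apply/is_hermitianmxP; rewrite expr0 scale1r.
  apply/matrixP=> i j; rewrite !mxE -[in LHS]M_sym mxE.
  by apply/esym/CrealP; rewrite complex_real.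
have /hermitian_normalmx/orthomx_spectralP := N_herm.
have D_real := hermitian_spectral_diag_real N_herm.
have P_unit := spectral_unitarymx N.
set P := spectralmx N in P_unit *; set D := spectral_diag N in D_real * => N_eq.
have D_le i : D 0 i <= f q.
  have /mxOverP/(_ 0 i)/complex_realP[a def_a] := D_real.
  rewrite def_a lecR; apply: Mq; rewrite -(eigenvalue_map f) -/N.
  apply/eigenvalueP; exists (row i P).
    rewrite -row_mul {1}N_eq !mulmxA mulmxV ?unitarymx_unit // mul1mx.
    by rewrite row_mul row_diag_mx -scalemxAl -rowE def_a.
  apply/eqP=> /(congr1 (mulmx^~ (invmx P))) /=.
  rewrite -row_mul mulmxV ?unitarymx_unit // mul0mx => /rowP/(_ i)/eqP.
  by rewrite !mxE eqxx oner_eq0.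
pose Z := map_mx f z; pose w := Z *m invmx P.
(* [P] is unitary and [z] is real, so these coordinates are the conjugates of those in [w]. *)
have wE : (P *m Z^T) = map_mx Num.conj w^T.
  rewrite /w invmx_unitary // trmx_mul map_mxM /= map_trmx trmxK -map_mx_comp.
  congr (_ *m _); last by rewrite map_trmx fC.
  by apply/matrixP=> i j; rewrite !mxE /= conjCK.
have quadE (E : 'rV_m) :
    (w *m diag_mx E *m (P *m Z^T)) 0 0 = \sum_i E 0 i * (w 0 i * (w 0 i)^*).
  rewrite wE mxE; apply: eq_bigr => i _; rewrite mul_mx_diag !mxE.
  by rewrite mulrA (mulrC (E 0 i)).
rewrite -lecR rmorphM /=.
have -> : ((z *m M *m z^T) 0 0)%:C%C = \sum_i D 0 i * (w 0 i * (w 0 i)^*).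
  rewrite -quadE.
  have -> : w *m diag_mx D *m (P *m Z^T) = Z *m N *m Z^T.
    by rewrite [in RHS]N_eq /w !mulmxA.
  by rewrite /Z /N map_trmx -!map_mxM [RHS]mxE.
have -> : ((z *m z^T) 0 0)%:C%C = \sum_i (w 0 i * (w 0 i)^*).
  have -> : \sum_i w 0 i * (w 0 i)^* = (w *m (P *m Z^T)) 0 0.
    by rewrite wE mxE; apply: eq_bigr => i _; rewrite !mxE.
  rewrite /w mulmxA mulmxKV ?unitarymx_unit //.
  by rewrite /Z map_trmx -map_mxM [RHS]mxE.
rewrite mulr_sumr; apply: ler_sum => i _.
by rewrite ler_wpM2r ?mul_conjC_ge0 // D_le.
Qed.

Lemma natr_degree (R : pzSemiRingType) (T : finType) (e : rel T) (x : T) :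
  (degree e x)%:R = \sum_y (e x y)%:R :> R.
Proof.
rewrite /degree -sum1dep_card natr_sum big_mkcond.
by apply: eq_bigr => y _; case: (e x y).
Qed.

(** The diagonal part counts [f u ^ 2] once per neighbour of [u], so it merges with the adjacency
    part into one sum over edges. *)
Lemma signless_quad (R : comNzRingType) (T : finType) (e : rel T) (f : T -> R) :
  let z := \row_i f (enum_val i) in
  (z *m signless_laplacian R e *m z^T) 0 0 =
    \sum_u \sum_v (e u v)%:R * (f u * (f u + f v)).
Proof.
move=> z.
have enum_sum (F : T -> R) : \sum_u F u = \sum_(i < #|T|) F (enum_val i).
  by rewrite (reindex _ (onW_bij _ (@enum_val_bij T))).
rewrite mulmxDr mulmxDl mxE [X in X + _]mxE [X in _ + X]mxE mul_mx_diag.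
under eq_bigr => j _ do rewrite !mxE mulr_suml.
rewrite exchange_big /= -big_split /= enum_sum; apply: eq_bigr => i _.
rewrite !mxE natr_degree mulr_sumr mulr_suml !enum_sum -big_split /=.
apply: eq_bigr => j _; rewrite !mxE; ring.
Qed.

(** The Rayleigh quotient of [N] is tested on the degrees in [M]. The outcome is that a sum of
    nonnegative terms [S u v] is at most zero, so every term vanishes. *)
Lemma signless_le_rigid (R : rcfType) (T : finType) (M N : rel T)
    (n : nat) (q : R) :
  symmetric M -> symmetric N -> subrel M N ->
  (forall u v, M u v -> n <= degree M u + degree M v)%N ->
  signless_radius N q -> q <= n%:R ->
  (forall u v, M u v -> degree M u + degree M v = n)%N /\
  (forall u v, N u v -> ~~ M u v -> degree M u = 0 /\ degree M v = 0)%N.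
Proof.
move=> M_sym N_sym MN M_ge [_ q_max] q_le.
pose d u : R := (degree M u)%:R.
have d_ge0 u : 0 <= d u by rewrite ler0n.
pose S u v : R :=
  (N u v)%:R * (d u + d v) ^+ 2 - n%:R * ((M u v)%:R * (d u + d v)).
have S_ge0 u v : 0 <= S u v.
  rewrite /S; case Muv: (M u v); last first.
    by rewrite mul0r mulr0 subr0 mulr_ge0 ?sqr_ge0 ?ler0n.
  rewrite (MN _ _ Muv) !mul1r expr2 -mulrBl.
  by apply: mulr_ge0; rewrite -natrD ?ler0n // subr_ge0 ler_nat M_ge.
have S_le0 : \sum_u \sum_v S u v <= 0.
  pose z : 'rV_#|T| := \row_i d (enum_val i).
  have /rayleigh_le/(_ q_max z) :
      (signless_laplacian R N)^T = signless_laplacian R N.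
    rewrite linearD /= tr_diag_mx; congr (_ + _).
    by apply/matrixP=> i j; rewrite !mxE N_sym.
  rewrite signless_quad.
  (* One factor of each [d u ^ 2] is expanded as a count of neighbours in [M]. *)
  have -> : (z *m z^T) 0 0 = \sum_u \sum_v (M u v)%:R * d u.
    rewrite mxE (reindex _ (onW_bij _ (@enum_val_bij T))) /=.
    by apply: eq_bigr => i _; rewrite !mxE -mulr_suml -natr_degree.
  set A := \sum_u _; set B := \sum_u _ => le_AB.
  have {}le_AB : A <= n%:R * B.
    apply: le_trans le_AB _; rewrite ler_wpM2r //.
    by apply: sumr_ge0 => u _; apply: sumr_ge0 => v _; rewrite mulr_ge0 ?ler0n.
  (* Adding the same sums with [u] and [v] exchanged makes the terms symmetric, whence the factor
     2. *)
  have -> : \sum_u \sum_v S u v = (A - n%:R * B) *+ 2.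
    have swapA : A = \sum_u \sum_v (N u v)%:R * (d v * (d u + d v)).
      rewrite /A exchange_big; apply: eq_bigr => u _; apply: eq_bigr => v _.
      by rewrite N_sym (addrC (d v)).
    have swapB : B = \sum_u \sum_v (M u v)%:R * d v.
      rewrite /B exchange_big; apply: eq_bigr => u _; apply: eq_bigr => v _.
      by rewrite M_sym.
    rewrite mulrnBl mulr2n -mulrnAr mulr2n {2}swapA {2}swapB /A /B.
    rewrite -!big_split /= mulr_sumr -sumrB; apply: eq_bigr => u _ /=.
    rewrite -!big_split /= mulr_sumr -sumrB; apply: eq_bigr => v _ /=.
    by rewrite -!mulrDr -mulrDl -expr2.
  by rewrite pmulrn_lle0 // subr_le0.
have S0 u v : S u v = 0.
  have row_ge0 w : 0 <= \sum_v S w v by apply: sumr_ge0.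
  have rows0 : \sum_u \sum_v S u v = 0.
    by apply: le_anti; rewrite S_le0 sumr_ge0.
  have row0 : \sum_v S u v = 0.
    exact: (psumr_eq0P (fun w _ => row_ge0 w) rows0).
  exact: (psumr_eq0P (fun w _ => S_ge0 u w) row0).
split=> u v.
  move=> Muv; have := S0 u v.
  rewrite /S Muv (MN _ _ Muv) !mul1r expr2 -mulrBl -natrD.
  move/eqP; rewrite mulf_eq0 subr_eq0 eqr_nat pnatr_eq0 => /orP[/eqP//|].
  by have := M_ge _ _ Muv; lia.
move=> Nuv nMuv; have := S0 u v.
rewrite /S Nuv (negbTE nMuv) mul0r mulr0 subr0 mul1r => /eqP.
by rewrite sqrf_eq0 -natrD pnatr_eq0 addn_eq0 => /andP[/eqP-> /eqP->].
Qed.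

(** * Hamiltonian paths and their reversals *)

Local Open Scope nat_scope.

(** With a function on [nat], reversals become index arithmetic. Only values below [#|T|] matter,
    and injectivity there already makes the path visit every vertex. *)
Definition hampath (T : finType) (h : rel T) (p : nat -> T) : Prop :=
  {in gtn #|T| &, injective p} /\ forall l, l.+1 < #|T| -> h (p l) (p l.+1).

(* Along a Hamiltonian path [p] of a bipartite graph, [x_i] is [p (2i)] and
   [y_i] is [p (2i+1)]. *)
Definition word (T : finType) (h : rel T) (p : nat -> T) (i : nat) : bool :=
  h (p 0) (p i.*2.+1).

(** This is the Posa rotation: its only new edge joins [p 0] to [p k.+1], and [p k] becomes the
    first vertex. *)
Definition flip_prefix (T : finType) (p : nat -> T) (k : nat) : nat -> T :=
  fun l => if l <= k then p (k - l) else p l.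

Definition rev_path (T : finType) (p : nat -> T) : nat -> T :=
  fun l => p (#|T|.-1 - l).

Section HamPath.
Variables (T : finType) (h : rel T).
Hypothesis h_sym : symmetric h.

Lemma hampath_eq p i j : hampath h p -> i < #|T| -> j < #|T| ->
  (p i == p j) = (i == j).
Proof.
by move=> [p_inj _] iT jT; apply/eqP/eqP=> [/p_inj-> //|->].
Qed.

Lemma hampath_surj p v : hampath h p -> exists2 l, l < #|T| & v = p l.
Proof.
move=> [p_inj _]; pose f (i : 'I_#|T|) := p i.
have f_inj : injective f.
  by move=> i j /p_inj eq_ij; apply/val_inj/eq_ij; exact: ltn_ord.
have [g _ gK] : bijective f by apply: inj_card_bij; rewrite ?card_ord.
by exists (g v); rewrite ?ltn_ord // -[in LHS](gK v).
Qed.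

Lemma hampath_flip p k : hampath h p -> k.+1 < #|T| -> h (p 0) (p k.+1) ->
  hampath h (flip_prefix p k).
Proof.
move=> hp kT pk; have [p_inj p_edge] := hp; split=> [i j iT jT /eqP|l lT].
  rewrite !inE in iT jT; rewrite /flip_prefix.
  by case: ifP => ik; case: ifP => jk; rewrite hampath_eq //; lia.
rewrite /flip_prefix; case: (ltngtP l k) => lk.
- by rewrite h_sym -[k - l]prednK ?subn_gt0 // -subnS p_edge //; lia.
- by rewrite p_edge.
- by rewrite lk subnn.
Qed.

Lemma hampath_rev p : hampath h p -> hampath h (rev_path p).
Proof.
move=> hp; have [p_inj p_edge] := hp; split=> [i j iT jT /eqP|l lT].
  rewrite !inE in iT jT; rewrite /rev_path.
  by rewrite hampath_eq //; lia.
rewrite /rev_path h_sym.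
have -> : #|T|.-1 - l = (#|T|.-1 - l.+1).+1 by lia.
by rewrite p_edge //; lia.
Qed.

Lemma hampath_hamiltonian p : 2 < #|T| -> hampath h p ->
  h (p #|T|.-1) (p 0) -> hamiltonian h.
Proof.
move=> T_gt2 hp pT; have [p_inj p_edge] := hp.
exists (mkseq p #|T|); split.
- by rewrite size_mkseq.
- rewrite /ucycle; apply/andP; split; last first.
    rewrite map_inj_in_uniq ?iota_uniq // => i j.
    by rewrite !mem_iota => iT jT; apply: p_inj.
  have s_sorted : sorted h (mkseq p #|T|).
    apply/(sortedP (p 0)) => i; rewrite size_mkseq => iT.
    by rewrite !nth_mkseq ?p_edge //; lia.
  have : h (last (p 0) (mkseq p #|T|)) (head (p 0) (mkseq p #|T|)).
    by rewrite -nth_last -nth0 size_mkseq !nth_mkseq //; lia.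
  by move: s_sorted; case: (mkseq p _) => //= x s; rewrite rcons_path => ->.
- move=> v; have [l lT ->] := hampath_surj v hp.
  by apply: map_f; rewrite mem_iota.
Qed.

End HamPath.

(** * Edge-maximal non-Hamiltonian extensions *)

Definition add_edge (T : finType) (h : rel T) (x y : T) : rel T :=
  fun u v => [|| h u v, (u == x) && (v == y) | (u == y) && (v == x)].

Lemma hampath_nth (T : finType) (h : rel T) (x0 : T) (s : seq T) :
  uniq s -> (forall v, v \in s) -> sorted h s ->
  size s = #|T| /\ hampath h (nth x0 s).
Proof.
move=> s_uniq s_all s_sorted.
have sT : size s = #|T|.
  by rewrite -(card_uniqP s_uniq); apply: eq_card => v; rewrite s_all.
split=> //; split=> [i j iT jT /eqP|l]; last by rewrite -sT; apply/sortedP.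
by rewrite nth_uniq ?sT // => /eqP.
Qed.

(** A Hamiltonian cycle must use the new edge, and deleting that edge leaves the path. Rotated to
    start at [x], the cycle can use it only in its first or last step; the rest avoids [x] and lies
    in [h]. *)
Lemma hampath_add_edge (T : finType) (h : rel T) (x y : T) :
  symmetric h -> x != y -> hamiltonian (add_edge h x y) -> ~ hamiltonian h ->
  exists p, [/\ hampath h p, p 0 = x & p #|T|.-1 = y].
Proof.
move=> h_sym xy [c [c_gt2 /andP[c_cyc c_uniq] c_all]] nonham.
have [i s def_c] := rot_to (c_all x).
have s_all v : v \in x :: s by rewrite -def_c mem_rot.
have s_uniq : uniq (x :: s) by rewrite -def_c rot_uniq.
have s_cyc : cycle (add_edge h x y) (x :: s) by rewrite -def_c rot_cycle.
have : 1 < size s by rewrite -[_ < _]/(2 < size (x :: s)) -def_c size_rot.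
case: s => // z s1 in def_c s_all s_uniq s_cyc *; rewrite ltnS => s1_gt0.
have s1_nx : all (predC1 x) (z :: s1).
  by case/andP: s_uniq => x_s _; apply/allP=> v; apply: contraTneq => ->.
(* As the cycle has length at least 3, its two steps at [x] lead to different vertices, so at most
   one of them is the new edge. *)
have [wz w_s1] : last z s1 != z /\ last z s1 != x.
  split; last by have /allP := s1_nx; apply; apply: mem_last.
  case/lastP: s1 s1_gt0 s_uniq {def_c s_all s_cyc s1_nx} => // s2 w _.
  rewrite last_rcons /= mem_rcons inE negb_or => /and3P[_ /andP[]].
  by rewrite eq_sym.
have zx : z != x by have /andP[] := s1_nx.
move: s_cyc; rewrite /= rcons_path => /and3P[xz s_path wx].
have {}s_path : path h z s1.
  apply: (@sub_in_path _ (predC1 x) _ _ _ _ _ s1_nx s_path) => u v.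
  by rewrite !inE /add_edge => /negbTE-> /negbTE->; rewrite !andbF !orbF.
have [zy|zy] := eqVneq z y.
  have s_sorted : sorted h (rcons (z :: s1) x).
    rewrite /= rcons_path s_path; move: wx; rewrite /add_edge (negbTE w_s1).
    by rewrite -zy (negbTE wz) !orbF.
  have s'_uniq : uniq (rcons (z :: s1) x).
    by rewrite rcons_uniq; case/andP: s_uniq => ->.
  have s'_all v : v \in rcons (z :: s1) x by rewrite mem_rcons.
  have [sT hp] := hampath_nth x s'_uniq s'_all s_sorted.
  exists (rev_path (nth x (rcons (z :: s1) x))); split.
  - exact: hampath_rev.
  - by rewrite /rev_path subn0 -sT nth_last last_rcons.
  - by rewrite /rev_path subnn.
have hxz : h x z.
  by move: xz; rewrite /add_edge (negbTE zy) (negbTE zx) !andbF !orbF.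
have s_sorted : sorted h (x :: z :: s1) by rewrite /= hxz.
have [sT hp] := hampath_nth x s_uniq s_all s_sorted.
have [wy|wy] := eqVneq (last z s1) y.
  exists (nth x (x :: z :: s1)); split=> //.
  by rewrite -sT nth_last.
case: nonham; apply: hampath_hamiltonian hp _ => //.
  by rewrite -sT.
rewrite -sT nth_last /=; move: wx.
by rewrite /add_edge (negbTE wy) (negbTE w_s1) !orbF.
Qed.

(** Missing edges between [X] and [Y] are added as long as the graph stays non-Hamiltonian, by
    induction on the number of nonadjacent pairs; at the end [hampath_add_edge] applies to each
    missing edge. *)
Lemma maximal_nonhamiltonian (T : finType) (e : rel T) (X Y : {set T}) :
  symmetric e -> has_partite_sets e X Y -> ~ hamiltonian e ->
  exists h : rel T,
    [/\ symmetric h, has_partite_sets h X Y, subrel e h, ~ hamiltonian h &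
        forall x y, x \in X -> y \in Y -> ~~ h x y ->
          exists p, [/\ hampath h p, p 0 = x & p #|T|.-1 = y]].
Proof.
have [m] := ubnP #|[set uv : T * T | ~~ e uv.1 uv.2]|.
elim: m e => // m IHm e e_m e_sym [XY dXY e_bip] e_nonham.
have neq x y : x \in X -> y \in Y -> x != y.
  by move=> xX yY; apply: contraTneq yY => <-; rewrite (disjointFr dXY).
have [[x [y [xX yY nxy nham]]]|maxl] := boolp.pselect
    (exists x y, [/\ x \in X, y \in Y, ~~ e x y &
       ~ hamiltonian (add_edge e x y)]).
  have [||||h [h_sym h_bip eh h_nonham h_max]] := IHm (add_edge e x y).
  - apply: leq_trans (e_m : _ <= m); apply: proper_card; apply/properP; split.
      by apply/subsetP=> -[u v]; rewrite !inE /add_edge; apply: contra => ->.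
    by exists (x, y); rewrite !inE /add_edge /= ?eqxx ?orbT.
  - move=> u v; rewrite /add_edge e_sym orbC [RHS]orbC; congr (_ || _).
    by rewrite orbC [(v == y) && _]andbC [(v == x) && _]andbC.
  - split=> // u v /or3P[/e_bip//|/andP[/eqP-> /eqP->]|/andP[/eqP-> /eqP->]].
      by rewrite xX yY.
    by rewrite xX yY orbT.
  - by [].
  by exists h; split=> // u v uv; apply: eh; rewrite /add_edge uv.
exists e; split=> // x y xX yY nxy.
apply: hampath_add_edge => //; first exact: neq.
by apply: boolp.contrapT => nham; apply: maxl; exists x, y.
Qed.

(** * Hamiltonian paths in a non-Hamiltonian balanced bipartite graph *)

Section Bipartite.
Variables (T : finType) (h : rel T) (X : {set T}) (n : nat).
Hypothesis h_sym : symmetric h.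
Hypothesis h_bip : forall u v, h u v -> (u \in X) != (v \in X).
Hypothesis cardT : #|T| = n.*2.
Hypothesis n_ge2 : 1 < n.
Hypothesis h_nonham : ~ hamiltonian h.

Lemma hampath_side p l : hampath h p -> l < n.*2 ->
  (p l \in X) = (p 0 \in X) (+) odd l.
Proof.
move=> [_ p_edge]; elim: l => [|l IHl] lT; first by rewrite addbF.
have /h_bip : h (p l) (p l.+1) by apply: p_edge; rewrite cardT.
rewrite IHl 1?ltnW //=.
by case: (p 0 \in X); case: (odd l); case: (p l.+1 \in X).
Qed.

Lemma same_side_nonadj p i j : hampath h p -> i < n.*2 -> j < n.*2 ->
  odd i = odd j -> h (p i) (p j) = false.
Proof.
move=> hp iT jT ij; apply: contraTF isT => /h_bip.
by rewrite (hampath_side hp iT) (hampath_side hp jT) ij eqxx.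
Qed.

(** Neighbours of [p a] sit at positions of the other parity; the boolean [~~ odd a] is added as 0
    or 1. *)
Lemma degree_hampath p a : hampath h p -> a < n.*2 ->
  degree h (p a) = #|[set i : 'I_n | h (p a) (p (i.*2 + ~~ odd a))]|.
Proof.
move=> hp aT; have [p_inj _] := hp; rewrite /degree.
pose f (i : 'I_n) := p (i.*2 + ~~ odd a).
have f_inj : injective f.
  move=> i j /p_inj; rewrite !inE cardT => ij; apply/val_inj => /=.
  by have := ltn_ord i; have := ltn_ord j; lia.
rewrite -(card_imset _ f_inj); apply: eq_card => v; rewrite !inE.
apply/idP/imsetP => [av|[i + ->]]; last by rewrite inE.
have [l lT def_v] := hampath_surj v hp; rewrite cardT in lT.
have a_l : odd l = ~~ odd a.
  apply: contraTeq av => al; rewrite def_v same_side_nonadj //.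
  by move: al; case: (odd a); case: (odd l).
have l2 : l./2 < n by lia.
have l_eq : l = l./2.*2 + ~~ odd a by rewrite -a_l addnC odd_double_half.
by exists (Ordinal l2); rewrite ?inE /f /= -l_eq -def_v.
Qed.

Lemma hampath_ends_nonadj p : hampath h p -> ~~ h (p 0) (p n.*2.-1).
Proof.
move=> hp; apply/negP=> p0; apply: h_nonham.
apply: hampath_hamiltonian hp _ => //; first by rewrite cardT; lia.
by rewrite cardT h_sym.
Qed.

(* If [p 0] is adjacent to [p (2i+1)] and [p (2n-1)] to [p (2i)], then
   [p 0 .. p (2i), p (2n-1) .. p (2i+1)] is a Hamiltonian cycle. *)
Lemma crossing p i : hampath h p -> i < n -> word h p i ->
  ~~ h (p n.*2.-1) (p i.*2).
Proof.
move=> hp iT wi; apply/negP=> p_end.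
apply: h_nonham.
have hf : hampath h (flip_prefix p i.*2).
  by apply: hampath_flip => //; rewrite cardT; lia.
apply: hampath_hamiltonian hf _ => //; first by rewrite cardT; lia.
rewrite cardT /flip_prefix leq0n subn0.
by have -> : (n.*2.-1 <= i.*2) = false by lia.
Qed.

Lemma degree_ends p : hampath h p ->
  [/\ degree h (p 0) = #|[set i : 'I_n | word h p i]|,
      degree h (p n.*2.-1) = #|[set i : 'I_n | h (p n.*2.-1) (p i.*2)]| &
      [set i : 'I_n | h (p n.*2.-1) (p i.*2)]
        \subset ~: [set i : 'I_n | word h p i]].
Proof.
move=> hp; split.
- rewrite degree_hampath //; last by lia.
  by apply: eq_card => i; rewrite !inE /word /= addn1.
- rewrite degree_hampath //; last by lia.
  apply: eq_card => i; rewrite !inE.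
  have -> : odd n.*2.-1 by lia.
  by rewrite addn0.
- apply/subsetP=> i; rewrite !inE; apply: contraL => wi.
  by rewrite crossing.
Qed.

(** Ore's counting: by [crossing], the neighbours of the two ends occupy disjoint sets of indices
    below [n]. *)
Lemma degree_ends_le p : hampath h p ->
  degree h (p 0) + degree h (p n.*2.-1) <= n.
Proof.
move=> /degree_ends[-> -> /subset_leq_card].
by have := cardsC [set i : 'I_n | word h p i]; rewrite card_ord; lia.
Qed.

(** * Adjacencies forced by extremal degree sums *)

Hypothesis degree_sum : forall u v,
  (u \in X) != (v \in X) -> ~~ h u v -> degree h u + degree h v = n.

(** The two ends are nonadjacent, so their degrees sum to exactly [n] and the inclusion in
    [degree_ends] is an equality. *)
Lemma end_adj p i : hampath h p -> i < n ->
  h (p n.*2.-1) (p i.*2) = ~~ word h p i.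
Proof.
move=> hp iT; have [d0 d1 sub] := degree_ends hp.
have : degree h (p 0) + degree h (p n.*2.-1) = n.
  apply: degree_sum; last exact: hampath_ends_nonadj.
  rewrite [in X in _ != X](hampath_side hp); last by lia.
  have -> : odd n.*2.-1 by lia.
  by case: (_ \in X).
have := cardsC [set i : 'I_n | word h p i]; rewrite card_ord => wC.
rewrite d0 d1 => d01; have /setP/(_ (Ordinal iT)) :
    [set i : 'I_n | h (p n.*2.-1) (p i.*2)] = ~: [set i : 'I_n | word h p i].
  apply/eqP; rewrite eqEcard sub -(leq_add2l #|[set i : 'I_n | word h p i]|).
  by rewrite wC d01 leqnn.
by rewrite !inE.
Qed.

Lemma word0 p : hampath h p -> word h p 0.
Proof. by move=> [_ p_edge]; apply: p_edge; rewrite cardT; lia. Qed.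

Lemma wordn p : hampath h p -> word h p n.-1 = false.
Proof.
move=> hp; apply: negbTE; rewrite /word.
have -> : n.-1.*2.+1 = n.*2.-1 by lia.
exact: hampath_ends_nonadj.
Qed.

Lemma hampath_flip_word p i : hampath h p -> i < n -> word h p i ->
  hampath h (flip_prefix p i.*2).
Proof. by move=> hp iT wi; apply: hampath_flip => //; rewrite cardT; lia. Qed.

(** The flip fixes the last vertex, whose adjacencies determine the word by [end_adj]. *)
Lemma word_flip p i j : hampath h p -> i < n -> j < n -> word h p i ->
  word h (flip_prefix p i.*2) j = word h p (if j <= i then i - j else j).
Proof.
move=> hp iT jT wi; have hf := hampath_flip_word hp iT wi.
apply: negb_inj; rewrite -end_adj // -end_adj //; last by case: ifP; lia.
rewrite /flip_prefix; have -> : (n.*2.-1 <= i.*2) = false by lia.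
by rewrite leq_double; case: ifP => // _; rewrite -doubleB.
Qed.

Lemma word_rev p i : hampath h p -> i < n ->
  word h (rev_path p) i = ~~ word h p (n.-1 - i).
Proof.
move=> hp iT; rewrite -end_adj //; last by lia.
by rewrite /word /rev_path cardT subn0; congr (h _ (p _)); lia.
Qed.

(** The path flipped at [x_i] starts there, so its word lists the neighbours of [x_i]. For [j < i]
    the vertex [y_j] gets index [i - j.+1] in it, which [word_flip] sends to [j.+1]. *)
Lemma adj_word p i j : hampath h p -> i < n -> j < n -> word h p i ->
  h (p i.*2) (p j.*2.+1) = word h p (if j < i then j.+1 else j).
Proof.
move=> hp iT jT wi; pose k := if j < i then i - j.+1 else j.
have -> : h (p i.*2) (p j.*2.+1) = word h (flip_prefix p i.*2) k.
  rewrite /word /flip_prefix subn0 leq0n /k; congr (h _ _).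
  by case: (ltnP j i) => ji; case: leqP => ?; congr (p _); lia.
rewrite word_flip //; last by rewrite /k; case: ifP; lia.
rewrite /k; case: (ltngtP j i) => ji; last by rewrite ji leqnn subnn wi word0.
  by case: leqP => ki; congr (word h p _); lia.
by case: leqP => ki //; lia.
Qed.

(** This mirrors [adj_word]: reversal turns [y_k] into the [x] of index [n.-1 - k] and complements
    the word. *)
Lemma adj_not_word p k j : hampath h p -> k < n -> j < n -> ~~ word h p k ->
  h (p k.*2.+1) (p j.*2) = ~~ word h p (if k < j then j.-1 else j).
Proof.
move=> hp kT jT wk; have hr := hampath_rev h_sym hp.
have wk' : word h (rev_path p) (n.-1 - k).
  by rewrite word_rev; [have -> : n.-1 - (n.-1 - k) = k by lia | |lia].
have -> : h (p k.*2.+1) (p j.*2) =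
    h (rev_path p (n.-1 - k).*2) (rev_path p (n.-1 - j).*2.+1).
  by rewrite /rev_path cardT; congr (h (p _) (p _)); lia.
rewrite adj_word //; [|lia|lia].
rewrite word_rev; [|by []|by case: ifP; lia].
by congr (~~ word h p _); case: ifP; case: ifP; lia.
Qed.


(** * The possible shapes of the word *)

(** Both sides tell whether [x_i] and [y_k] are adjacent, one by [adj_word] and the other by
    [adj_not_word]. *)
Lemma word_exchange p k i : hampath h p -> k < i < n -> ~~ word h p k ->
  word h p i -> word h p k.+1 = ~~ word h p i.-1.
Proof.
move=> hp /andP[ki iT] wk wi.
have := adj_word hp iT (ltn_trans ki iT) wi.
by rewrite h_sym (adj_not_word hp (ltn_trans ki iT) iT wk) ki.
Qed.

(** With ones at [i] and [i.+1], exchanging [k] with [i.+1] moves the zero from [k] to [k.+1];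
    repeating this brings a zero to [i]. *)
Lemma word_no_repeat_after p k i : hampath h p -> k < i -> i.+1 < n ->
  ~~ word h p k -> word h p i -> ~~ word h p i.+1.
Proof.
move=> hp; have [m] := ubnP (i - k).
elim: m k => // m IHm k ik_m ki iT wk wi; apply/negP=> wi1.
have := word_exchange hp (_ : k < i.+1 < n) wk wi1.
rewrite ltnW //= wi => /(_ iT) /negbT wk1.
have k1i : k.+1 < i by rewrite ltn_neqAle ki andbT; apply: contraNneq wk1 => ->.
by move: wi1; apply/negP; apply: (IHm k.+1) => //; lia.
Qed.

Lemma word_no_repeat p k l i : hampath h p -> k < l < n -> ~~ word h p k ->
  word h p l -> i.+1 < n -> word h p i -> ~~ word h p i.+1.
Proof.
move=> hp /andP[kl lT] wk wl iT wi.
case: (ltngtP k i) => [ki|ik|ki]; last by rewrite ki wi in wk.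
  exact: (word_no_repeat_after hp ki).
apply/negP=> wi1; have i1k : i.+1 < k.
  by rewrite ltn_neqAle ik andbT; apply: contraNneq wk => <-.
(* The repetition precedes the zero at [k]; reversing the prefix up to [l] puts it after that
   zero. *)
have hf := hampath_flip_word hp lT wl.
have wf j : j <= l -> word h (flip_prefix p l.*2) (l - j) = word h p j.
  move=> jl; rewrite word_flip //; last by lia.
  by rewrite leq_subr subKn.
have : ~~ word h (flip_prefix p l.*2) (l - i.+1).+1.
  by apply: (word_no_repeat_after hf (_ : l - k < _)); rewrite ?wf //; lia.
by rewrite (_ : (l - i.+1).+1 = l - i) ?wf ?wi //; lia.
Qed.

(** Two consecutive ones are excluded by [word_no_repeat], and two consecutive zeros by the same
    lemma for the reversed path, whose word is complemented. *)
Lemma word_alternates p k l i : hampath h p -> k < l < n -> ~~ word h p k ->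
  word h p l -> i < n -> word h p i = ~~ odd i.
Proof.
move=> hp kln wk wl; have [kl lT] := andP kln.
elim: i => [|i IHi] iT; first by rewrite word0.
have {}IHi := IHi (ltnW iT); rewrite /= -IHi.
case wi: (word h p i).
  by rewrite (negbTE (word_no_repeat hp kln wk wl iT wi)).
apply/negbNE/negP=> wi1.
have hr := hampath_rev h_sym hp.
have wr j : j < n -> word h (rev_path p) (n.-1 - j) = ~~ word h p j.
  move=> jT; rewrite word_rev //; last by lia.
  by congr (~~ word h p _); lia.
have kln' : n.-1 - l < n.-1 - k < n by lia.
have : ~~ word h (rev_path p) (n.-1 - i.+1).+1.
  apply: (word_no_repeat hr kln'); rewrite ?wr ?wl //; last by lia.
  by lia.
by rewrite (_ : (n.-1 - i.+1).+1 = n.-1 - i) ?wr ?wi //; lia.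
Qed.

(** The first zero is at [s]: either no one follows it, or a later one forces alternation. *)
Lemma word_shape p : hampath h p ->
  (exists2 s, 0 < s < n & forall i, i < n -> word h p i = (i < s)) \/
  3 < n /\ forall i, i < n -> word h p i = ~~ odd i.
Proof.
move=> hp.
have ex_neg : exists i, ~~ word h p i by exists n.-1; rewrite wordn.
case: (ex_minnP ex_neg) => s ws s_min.
have s_gt0 : 0 < s by case: (s) ws => //; rewrite word0.
have s_lt : s < n by have := s_min n.-1; rewrite wordn // => /(_ isT); lia.
have [|] := boolP [exists i : 'I_n, (s < i) && word h p i].
  move=> /existsP[i /andP[si wi]].
  right; have si_n : s < i < n by rewrite si /=.
  split; last by move=> j; apply: (word_alternates hp si_n).
  (* The later one has an even index that is positive and not last, which leaves only [n > 3]. *)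
  have : i != n.-1 :> nat by apply: contraTneq wi => ->; rewrite wordn.
  have := ltn_ord i.
  have := word_alternates hp si_n ws wi (ltn_ord i); rewrite wi => /esym.
  by lia.
rewrite negb_exists => /forallP no_inv.
left; exists s; first by rewrite s_gt0.
move=> i iT; case: (ltngtP i s) => [i_s|si|->]; last exact: negbTE.
  by apply: contraTT i_s => /s_min; rewrite -leqNgt.
by have := no_inv (Ordinal iT); rewrite si /= => /negbTE.
Qed.

Lemma opposite_sides p i j : hampath h p -> i < n.*2 -> j < n.*2 ->
  odd i != odd j -> (p i \in X) != (p j \in X).
Proof.
move=> hp iT jT; rewrite (hampath_side hp iT) (hampath_side hp jT).
by case: (odd i); case: (odd j); case: (p 0 \in X).
Qed.

(** * Alternating words *)

(** The pair [x_1], [y_2] is covered neither by [adj_word] nor by [adj_not_word]. Were it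
    nonadjacent, the chain of nonadjacent pairs through [x_1], [y_2], [x_4], [y_(n-1)], [x_0] would
    give [x_1] the degree of [x_0], which is half of [n]; but [x_1] has more neighbours. *)
Lemma alternating_adj25 p : hampath h p -> 5 < n ->
  (forall i, i < n -> word h p i = ~~ odd i) -> h (p 2) (p 5).
Proof.
move=> hp n_gt5 alt; apply/negPn/negP=> n25.
have n_even : ~~ odd n.
  by have := alt n.-1; rewrite wordn // => /(_ _)/esym; lia.
have hr := hampath_rev h_sym hp.
have nonadj i j : i < n.*2 -> j < n.*2 -> odd i != odd j ->
    ~~ h (p i) (p j) -> degree h (p i) + degree h (p j) = n.
  by move=> iT jT ij; apply: degree_sum; apply: opposite_sides.
have d25 : degree h (p 2) + degree h (p 5) = n by apply: nonadj => //; lia.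
have adj8 j : j < n ->
    h (p 8) (p j.*2.+1) = word h p (if j < 4 then j.+1 else j).
  by move=> jT; apply: (@adj_word p 4) => //; rewrite ?alt //; lia.
have d85 : degree h (p 8) + degree h (p 5) = n.
  apply: nonadj => //; try lia.
  by rewrite (adj8 2) ?alt //; lia.
have d8n : degree h (p 8) + degree h (p n.*2.-1) = n.
  apply: nonadj; try lia.
  rewrite (_ : n.*2.-1 = n.-1.*2.+1); last by lia.
  rewrite adj8; last by lia.
  by rewrite (_ : n.-1 < 4 = false) ?wordn //; lia.
have d0n : degree h (p 0) + degree h (p n.*2.-1) = n.
  by apply: nonadj; rewrite ?hampath_ends_nonadj //; lia.
have [d0 _ _] := degree_ends hp.
have [dr _ _] := degree_ends hr.
(* For even [n] the alternating word is its own reversed complement. *)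
have d0_eq : degree h (p 0) = degree h (p n.*2.-1).
  have -> : p n.*2.-1 = rev_path p 0 by rewrite /rev_path subn0 cardT.
  rewrite d0 dr; apply: eq_card => i; rewrite !inE word_rev // !alt //; try lia.
  by have := ltn_ord i; lia.
(* [x_1] is adjacent to every [y_i] with [i] odd, and to [y_0] along the path. *)
have d2 : degree h (p 2) > #|~: [set i : 'I_n | word h p i]|.
  rewrite (degree_hampath hp) /=; last by lia.
  apply: proper_card; apply/properP; split.
    apply/subsetP=> i; rewrite !inE addn1 => wi.
    rewrite h_sym (@adj_not_word p i 1) //.
    rewrite alt // in wi.
    by case: ifP => i1; rewrite alt //; lia.
  have n_gt0 : 0 < n by lia.
  exists (Ordinal n_gt0); rewrite !inE ?word0 //= h_sym.
  by have [_] := hp; apply; rewrite cardT; lia.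
have := cardsC [set i : 'I_n | word h p i]; rewrite card_ord -d0.
by lia.
Qed.

(** The prefix 10101 is a palindrome, so flipping at [p 8] keeps the word. Then [alternating_adj25]
    for the flipped path joins [p 6] to [p 3], which contradicts [adj_not_word]. *)
Lemma alternating_word_small p : hampath h p ->
  (forall i, i < n -> word h p i = ~~ odd i) -> n <= 5.
Proof.
move=> hp alt; rewrite leqNgt; apply/negP=> n_gt5.
have w4 : word h p 4 by rewrite alt //; lia.
have lt4n : 4 < n by lia.
have hf := hampath_flip_word hp lt4n w4.
have := alternating_adj25 hf n_gt5.
rewrite /flip_prefix /= h_sym => adj36.
have : h (p 3) (p 6).
  apply: adj36 => i iT; rewrite word_flip //.
  by case: ifP => i4; rewrite alt //; lia.
rewrite (@adj_not_word p 1 3) //; try lia; last by rewrite alt //; lia.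
by rewrite /= alt //; lia.
Qed.

(* An edge [p 1, p 6] would close [p 0, p 1, p 6, p 7, p 2, p 3, p 4, p 5] to a
   Hamiltonian cycle. *)
Lemma alternating4_nonadj61 p : hampath h p -> n = 4 ->
  (forall i, i < n -> word h p i = ~~ odd i) -> ~~ h (p 6) (p 1).
Proof.
move=> hp n4 alt; apply/negP=> adj61; have [p_inj p_edge] := hp.
apply: h_nonham; exists (map p [:: 0; 1; 6; 7; 2; 3; 4; 5]).
have T8 : #|T| = 8 by rewrite cardT n4.
split=> //; last first.
  move=> v; have [l lT ->] := hampath_surj v hp; apply: map_f.
  by rewrite T8 in lT; do 8?[case: l lT => // l lT].
apply/andP; split; last first.
  rewrite map_inj_in_uniq // => i j iT jT; apply: p_inj; rewrite inE T8.
    by move: iT; rewrite !inE; lia.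
  by move: jT; rewrite !inE; lia.
have edge l : l < 7 -> h (p l) (p l.+1) by move=> lT; apply: p_edge; rewrite T8.
have adj72 : h (p 7) (p 2).
  by have := end_adj hp (_ : 1 < n); rewrite n4 alt ?n4 // => ->.
have adj05 : h (p 0) (p 5) by have := alt 2; rewrite n4 => /(_ isT).
by rewrite /= !edge // h_sym adj61 adj72 h_sym adj05.
Qed.

End Bipartite.

(** * Recognition of the exceptional graphs *)

Lemma graph_iso_of_injective (T U : finType) (e : rel T) (f : rel U)
    (psi : U -> T) :
  injective psi -> #|T| <= #|U| -> (forall u v, e (psi u) (psi v) = f u v) ->
  graph_iso e f.
Proof.
move=> psi_inj TU psiE; have [phi psiK phiK] := inj_card_bij psi_inj TU.
by exists phi => [|x y]; [exists psi | rewrite -psiE !phiK].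
Qed.

(** Only the pairs [y_j], [x_i] with [j < s <= i] are left free: they carry the arbitrary bipartite
    graph, with [X0] made of these [y_j] and [Y0] of these [x_i]. The other vertices are the added
    ones. *)
Lemma in_B_threshold (T : finType) (e : rel T) (p : nat -> T) (n s : nat) :
  symmetric e -> #|T| = n.*2 -> {in gtn #|T| &, injective p} -> 0 < s < n ->
  (forall i j, i < n.*2 -> j < n.*2 ->
     odd i = odd j -> e (p i) (p j) = false) ->
  (forall i j, i < s -> j < n -> e (p i.*2) (p j.*2.+1) = (j < s)) ->
  (forall k j, s <= k < n -> j < n -> e (p k.*2.+1) (p j.*2) = (s <= j)) ->
  in_B n s e.
Proof.
move=> e_sym cardT p_inj /andP[s_gt0 s_lt] e_par e_lo e_hi.
pose r (j : 'I_s) (k : 'I_(n - s)) := e (p j.*2.+1) (p (s + k).*2).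
pose ix (u : ('I_s + 'I_(n - s)) + ('I_s + 'I_(n - s))) : nat :=
  match u with
  | inl (inl j) => j.*2.+1
  | inl (inr k) => (s + k).*2
  | inr (inl i) => i.*2
  | inr (inr k) => (s + k).*2.+1
  end.
have ix_lt u : ix u < n.*2.
  by case: u => -[] i /=; have := ltn_ord i; lia.
have ix_inj : injective ix.
  by move=> [[] i|[] i] [[] j|[] j] /= ij; have := ltn_ord i; have := ltn_ord j;
     move=> *; do ?congr (_ _); try (by apply: val_inj => /=; lia); lia.
pose X0 := [set u : 'I_s + 'I_(n - s) | if u is inl _ then true else false].
pose Y0 := [set u : 'I_s + 'I_(n - s) | if u is inr _ then true else false].
have card_l : #|X0| = s.
  rewrite (_ : X0 = [set inl i | i in [set: 'I_s]]).
    by rewrite card_imset ?cardsT ?card_ord //; apply: inl_inj.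
  apply/setP=> -[] i; rewrite inE; apply/esym; first by rewrite imset_f.
  by apply/imsetP=> -[].
have card_r : #|Y0| = n - s.
  rewrite (_ : Y0 = [set inr i | i in [set: 'I_(n - s)]]).
    by rewrite card_imset ?cardsT ?card_ord //; apply: inr_inj.
  apply/setP=> -[] i; rewrite inE; apply/esym; last by rewrite imset_f.
  by apply/imsetP=> -[].
exists ('I_s + 'I_(n - s))%type, (bipartite_rel r), X0, Y0.
split=> //.
- by split=> [[] i [] j|[] i] //=.
- split.
  + by apply/setP=> -[] i; rewrite !inE.
  + by rewrite disjoint_subset; apply/subsetP=> -[] i; rewrite !inE.
  + by move=> [] i [] j //=; rewrite !inE.
apply: (graph_iso_of_injective (psi := p \o ix)).
- by move=> u v /p_inj; rewrite !inE cardT !ix_lt => /(_ isT isT)/ix_inj.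
- by rewrite cardT !card_sum !card_ord; lia.
move=> [[] i|[] i] [[] j|[] j] /=;
  have := ltn_ord i; have := ltn_ord j => jT iT;
  rewrite ?inE //; try (by apply: e_par; lia).
- by rewrite e_sym e_lo //; lia.
- by rewrite e_sym e_hi //; lia.
- by rewrite e_lo //; lia.
- by rewrite e_lo //; lia.
- by rewrite e_hi //; lia.
- by rewrite e_hi //; lia.
Qed.

Lemma Gamma_alternating (T : finType) (e : rel T) (p : nat -> T) :
  symmetric e -> #|T| = 8 -> {in gtn #|T| &, injective p} ->
  (forall i j, i < 8 -> j < 8 -> odd i = odd j -> e (p i) (p j) = false) ->
  (forall i j, i < 4 -> j < 4 -> (i, j) != (1, 2) ->
    e (p i.*2) (p j.*2.+1) =
      ((i, j) \in [:: (0, 0); (0, 2); (1, 0); (1, 1); (1, 3);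
                      (2, 1); (2, 2); (3, 2); (3, 3)])) ->
  graph_iso e Gamma1 \/ graph_iso e Gamma2.
Proof.
move=> e_sym cardT p_inj e_par e_adj.
(* [t_1] and [b_1] go to [x_1] and [y_2], the undetermined pair that decides between the two
   graphs. *)
pose ix (u : 'I_4 + 'I_4) : nat :=
  match u with
  | inl i => nth 0 [:: 2; 0; 4; 6] i
  | inr j => nth 0 [:: 5; 1; 3; 7] j
  end.
have ix_lt u : ix u < 8 by case: u => -[[|[|[|[|i]]]] iT].
have ix_inj : injective ix.
  by move=> [[[|[|[|[|i]]]] iT]|[[|[|[|[|i]]]] iT]] // 
     [[[|[|[|[|j]]]] jT]|[[|[|[|[|j]]]] jT]] //= _; congr (_ _); apply: val_inj.
have pix_inj : injective (p \o ix).
  by move=> u v /p_inj; rewrite !inE cardT !ix_lt => /(_ isT isT)/ix_inj.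
have cardU : #|T| <= #|{: 'I_4 + 'I_4}| by rewrite cardT card_sum !card_ord.
have same_l i j : e (p (ix (inl i))) (p (ix (inl j))) = false.
  apply: e_par => //; case: i j => [[|[|[|[|i]]]] iT] [[|[|[|[|j]]]] jT] //.
have same_r i j : e (p (ix (inr i))) (p (ix (inr j))) = false.
  apply: e_par => //; case: i j => [[|[|[|[|i]]]] iT] [[|[|[|[|j]]]] jT] //.
have adj i j : (i != ord0) || (j != ord0) ->
    e (p (ix (inl i))) (p (ix (inr j))) = Gamma1 (inl i) (inr j).
  have -> : ix (inl i) = (nth 0 [:: 1; 0; 2; 3] i).*2.
    by case: i => [[|[|[|[|i]]]] iT].
  have -> : ix (inr j) = (nth 0 [:: 2; 0; 1; 3] j).*2.+1.
    by case: j => [[|[|[|[|j]]]] jT].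
  by case: i j => [[|[|[|[|i]]]] iT] [[|[|[|[|j]]]] jT] //= _; rewrite e_adj.
have adj0 : e (p (ix (inl ord0))) (p (ix (inr ord0))) = e (p 2) (p 5) by [].
have eqE : ((forall i j : 'I_4, (inl i == inl j :> 'I_4 + 'I_4) = (i == j)) *
           (forall i j : 'I_4, (inr i == inr j :> 'I_4 + 'I_4) = (i == j))) *
           ((forall i j : 'I_4, (inl i == inr j :> 'I_4 + 'I_4) = false) *
           (forall i j : 'I_4, (inr i == inl j :> 'I_4 + 'I_4) = false)) by [].
case e25: (e (p 2) (p 5)); [right | left];
  apply: (graph_iso_of_injective pix_inj cardU) => -[] i [] j;
  rewrite /comp ?same_l ?same_r // 1?e_sym /Gamma2 ?eqE ?andbF ?orbF //.
- have [->|i0] := eqVneq i ord0; last by rewrite e_sym adj ?i0 // orbF.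
  by have [->|j0] := eqVneq j ord0; rewrite e_sym ?adj0 // adj ?j0 ?orbT ?orbF.
- have [->|i0] := eqVneq i ord0; last by rewrite adj ?i0 ?orbT // orbF.
  by have [->|j0] := eqVneq j ord0; rewrite ?adj0 // adj ?j0 ?orbT ?orbF.
- have [->|i0] := eqVneq i ord0; last by rewrite e_sym adj ?i0.
  by have [->|j0] := eqVneq j ord0; rewrite e_sym ?adj0 // adj ?j0 ?orbT.
- have [->|i0] := eqVneq i ord0; last by rewrite adj ?i0 ?orbT.
  by have [->|j0] := eqVneq j ord0; rewrite ?adj0 // adj ?j0 ?orbT.
Qed.

(** * From the spectral bound to a tight extension *)

Lemma card_bipartite (T : finType) (e : rel T) (X Y : {set T}) :
  has_partite_sets e X Y -> #|T| = #|X| + #|Y|.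
Proof.
by move=> [XY dXY _]; rewrite -cardsT -XY cardsU disjoint_setI0 // cards0 subn0.
Qed.

Lemma in_right_part (T : finType) (e : rel T) (X Y : {set T}) v :
  has_partite_sets e X Y -> (v \in Y) = (v \notin X).
Proof.
move=> [XY dXY _]; have := in_setT v; rewrite -XY inE.
by case vX: (v \in X) => //=; rewrite (disjointFr dXY).
Qed.

(** This rules out a maximal extension without missing edges, for which maximality would provide no
    Hamiltonian path. *)
Lemma complete_bipartite_hamiltonian (T : finType) (h : rel T)
    (X Y : {set T}) (n : nat) :
  symmetric h -> has_partite_sets h X Y -> #|X| = n -> #|Y| = n -> 1 < n ->
  (forall x y, x \in X -> y \in Y -> h x y) -> hamiltonian h.
Proof.
move=> h_sym h_bip cardX cardY n_gt1 h_all; have [_ dXY _] := h_bip.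
have cardT : #|T| = n.*2 by rewrite (card_bipartite h_bip) cardX cardY addnn.
have [x0 _] : exists x, x \in X by apply/card_gt0P; rewrite cardX; lia.
pose p l := nth x0 (if odd l then enum Y else enum X) l./2.
have pX l : l < n.*2 -> ~~ odd l -> p l \in X.
  move=> lT /negbTE el; rewrite -mem_enum /p el mem_nth // -cardE cardX; lia.
have pY l : l < n.*2 -> odd l -> p l \in Y.
  move=> lT ol; rewrite -mem_enum /p ol mem_nth // -cardE cardY; lia.
have hp : hampath h p.
  split=> [i j|l]; rewrite ?inE cardT; [move=> iT jT pij|move=> iT].
    have odd_ij : odd i = odd j.
      case oi: (odd i); case oj: (odd j) => //.
        by have := pY _ iT oi; rewrite pij (disjointFr dXY) ?pX ?oj.
      by have := pY _ jT oj; rewrite -pij (disjointFr dXY) ?pX ?oi.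
    suff : i./2 = j./2 by lia.
    have sz : size (if odd i then enum Y else enum X) = n.
      by case: ifP; rewrite -cardE.
    move: pij => /eqP; rewrite /p -odd_ij nth_uniq ?sz.
    - by move/eqP.
    - lia.
    - lia.
    - by case: ifP; rewrite enum_uniq.
  case ol: (odd l); last by apply: h_all; rewrite ?pX ?pY //= ?ol // ltnW.
  by rewrite h_sym; apply: h_all; rewrite ?pX ?pY //= ?ol // ltnW.
apply: hampath_hamiltonian hp _ => //; first by rewrite cardT; lia.
by rewrite h_sym h_all ?pX ?pY ?cardT //; lia.
Qed.

Lemma degree_quasi_complement (T : finType) (h : rel T) (X Y : {set T})
    (n : nat) (u : T) :
  has_partite_sets h X Y -> #|X| = n -> #|Y| = n ->
  degree (quasi_complement X Y h) u + degree h u = n.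
Proof.
move=> h_part cardX cardY; have [_ _ h_bip] := h_part.
rewrite /degree /quasi_complement.
set A := finset _; set B := finset _.
have dAB : [disjoint A & B].
  by rewrite disjoint_subset; apply/subsetP=> v; rewrite !inE => /andP[].
have <- : #|A :|: B| = #|A| + #|B|.
  by rewrite cardsU disjoint_setI0 // cards0 subn0.
have sides v := in_right_part v h_part.
have [uX|uX] := boolP (u \in X).
  rewrite -cardY; apply: eq_card => v; rewrite !inE uX !sides uX /= orbF.
  case uv: (h u v); rewrite ?andbT ?orbF //.
  by have := h_bip _ _ uv; rewrite !sides uX /= orbF => ->.
rewrite -cardX; apply: eq_card => v; rewrite !inE !sides uX /=.
rewrite (negbTE uX) /=; case uv: (h u v); rewrite ?andbT ?orbF //.
by have := h_bip _ _ uv; rewrite !sides (negbTE uX) /= => ->.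
Qed.

Lemma tight_nonhamiltonian_extension (R : rcfType) (T : finType) (e : rel T)
    (X Y : {set T}) (n : nat) (q : R) :
  1 < n -> symmetric e -> has_partite_sets e X Y -> #|X| = n -> #|Y| = n ->
  signless_radius (quasi_complement X Y e) q -> (q <= n%:R)%R ->
  ~ hamiltonian e ->
  exists h : rel T,
    [/\ [/\ symmetric h, subrel e h &
         forall u v, h u v -> (u \in X) != (v \in X)],
        ~ hamiltonian h, exists p, hampath h p,
        (forall u v, (u \in X) != (v \in X) -> ~~ h u v ->
          degree h u + degree h v = n) &
        (forall u v w, (u \in X) != (w \in X) -> ~~ h u w -> e u v = h u v)].
Proof.
move=> n_ge2 e_sym e_bip cardX cardY q_radius q_le e_nonham.
have [h [h_sym h_bip eh h_nonham h_max]] :=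
  maximal_nonhamiltonian e_sym e_bip e_nonham.
have [_ _ h_sides] := h_bip.
have cardT : #|T| = n.*2 by rewrite (card_bipartite e_bip) cardX cardY addnn.
have sides v := in_right_part v e_bip.
have h_opp u v : h u v -> (u \in X) != (v \in X).
  by move/h_sides; rewrite !sides; case: (u \in X); case: (v \in X).
pose M := quasi_complement X Y h; pose N := quasi_complement X Y e.
have NE u v : N u v = ((u \in X) != (v \in X)) && ~~ e u v.
  by rewrite /N /quasi_complement !sides; case: (u \in X); case: (v \in X).
have ME u v : M u v = ((u \in X) != (v \in X)) && ~~ h u v.
  by rewrite /M /quasi_complement !sides; case: (u \in X); case: (v \in X).
have degM u : degree M u + degree h u = n by apply: degree_quasi_complement.
have M_sym : symmetric M by move=> u v; rewrite !ME h_sym eq_sym.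
have N_sym : symmetric N by move=> u v; rewrite !NE e_sym eq_sym.
have MN : subrel M N.
  by move=> u v; rewrite ME NE => /andP[-> /=]; apply: contra; apply: eh.
(* Ore's bound for [h], read in the quasi-complement, is the hypothesis that [signless_le_rigid]
   needs. *)
have M_ge u v : M u v -> n <= degree M u + degree M v.
  wlog uX : u v / u \in X.
    move=> wlg Muv; have [uX|uX] := boolP (u \in X); first exact: wlg.
    rewrite addnC; apply: wlg; last by rewrite M_sym.
    by move: Muv; rewrite ME (negbTE uX); case: (v \in X).
  rewrite ME uX /= => /andP[vX nuv].
  have [||p [hp p0 pn]] := h_max u v _ _ nuv; rewrite ?sides //.
  have := degree_ends_le h_sym h_opp cardT n_ge2 h_nonham hp.
  rewrite p0 -cardT pn.
  by have := degM u; have := degM v; lia.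
have [M_eq M_iso] := signless_le_rigid M_sym N_sym MN M_ge q_radius q_le.
have deg_sum u v : (u \in X) != (v \in X) -> ~~ h u v ->
    degree h u + degree h v = n.
  move=> uv nuv; have /M_eq : M u v by rewrite ME uv.
  by have := degM u; have := degM v; lia.
(* A vertex with a missing edge in [h] has positive degree in [M], so by rigidity [e] lacks no edge
   of [h] there. *)
have e_eq u v w : (u \in X) != (w \in X) -> ~~ h u w -> e u v = h u v.
  move=> uw nuw; apply/idP/idP=> [/eh//|huv]; apply: contraLR isT => neuv.
  have [||+ _] := M_iso u v; rewrite ?NE ?ME ?h_opp ?huv ?neuv //.
  move/eqP; rewrite /degree cards_eq0 => /eqP/setP/(_ w).
  by rewrite !inE ME uw nuw.
exists h; split=> //.
apply: boolp.contrapT => no_path; apply: h_nonham.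
apply: (complete_bipartite_hamiltonian h_sym h_bip cardX cardY n_ge2).
move=> x y xX yY.
apply: contraT => nxy; have [p [hp _ _]] := h_max x y xX yY nxy.
by case: no_path; exists p.
Qed.

(** * Classification of the tight cases *)

Lemma tight_nonhamiltonian_exceptional (T : finType) (e h : rel T) (X : {set T})
    (n : nat) (p : nat -> T) :
  1 < n -> #|T| = n.*2 -> symmetric e -> symmetric h -> subrel e h ->
  (forall u v, h u v -> (u \in X) != (v \in X)) -> ~ hamiltonian h ->
  (forall u v, (u \in X) != (v \in X) -> ~~ h u v ->
     degree h u + degree h v = n) ->
  (forall u v w, (u \in X) != (w \in X) -> ~~ h u w -> e u v = h u v) ->
  hampath h p ->
  (exists2 k, 1 <= k <= n./2 & in_B n k e) \/
  n = 4 /\ (graph_iso e Gamma1 \/ graph_iso e Gamma2).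
Proof.
move=> n_ge2 cardT e_sym h_sym eh h_opp h_nonham deg_sum e_eq hp.
have e_par p' i j : hampath h p' -> i < n.*2 -> j < n.*2 -> odd i = odd j ->
    e (p' i) (p' j) = false.
  move=> hp' iT jT ij; apply: negbTE; apply/negP=> /eh.
  by rewrite (same_side_nonadj h_opp cardT hp').
have opp p' i j : hampath h p' -> i < n.*2 -> j < n.*2 -> odd i != odd j ->
    (p' i \in X) != (p' j \in X).
  exact: opposite_sides.
have adjS := adj_word h_sym h_opp cardT n_ge2 h_nonham deg_sum.
have adjN := adj_not_word h_sym h_opp cardT n_ge2 h_nonham deg_sum.
have threshold p' s : hampath h p' -> 0 < s < n ->
    (forall i, i < n -> word h p' i = (i < s)) -> in_B n s e.
  move=> hp' s_n wE; have [p_inj _] := hp'.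
  have loE i j : i < s -> j < n -> h (p' i.*2) (p' j.*2.+1) = (j < s).
    move=> i_s jT; have iT : i < n by lia.
    rewrite (adjS p' i j) // ?wE //; last by case: ifP; lia.
    by case: ifP; lia.
  have hiE k j : s <= k < n -> j < n -> h (p' k.*2.+1) (p' j.*2) = (s <= j).
    move=> k_s jT; have kT : k < n by lia.
    rewrite (adjN p' k j) // ?wE //; [|by case: ifP; lia|by lia].
    by case: ifP; lia.
  apply: (in_B_threshold (p := p')) => // [i j|i j i_s jT|k j k_s jT].
  - exact: e_par.
  (* [x_i] with [i < s] misses [y_(n-1)] in [h], and below [y_k] with [s <= k] misses [x_0]; hence
     [e] and [h] agree at these vertices. *)
  - rewrite (e_eq _ _ (p' n.-1.*2.+1)) ?loE //; try lia.
    by apply: opp => //; lia.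
  - rewrite (e_eq _ _ (p' 0)) ?hiE //; try lia.
      by apply: opp => //; lia.
    by rewrite -[0]/(0.*2) hiE //; lia.
have [[s s_n wE]|[n_gt3 alt]] :=
    word_shape h_sym h_opp cardT n_ge2 h_nonham deg_sum hp.
  left; have [s_le|s_gt] := leqP s n./2.
    by exists s; [lia | exact: threshold hp s_n wE].
  (* Too long a block of ones is shortened by reversing the path, which leaves [n - s] ones. *)
  have hr := hampath_rev h_sym hp.
  exists (n - s); first by lia.
  apply: threshold hr _ _; first by lia.
  move=> i iT; rewrite (word_rev h_sym h_opp cardT n_ge2 h_nonham deg_sum) //.
  by rewrite wE; lia.
have n_le5 :=
  alternating_word_small h_sym h_opp cardT n_ge2 h_nonham deg_sum hp alt.
(* An alternating word that ends in a zero has even length, which excludes 5. *)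
have n4 : n = 4.
  have := wordn h_sym cardT n_ge2 h_nonham hp.
  by rewrite alt; lia.
right; split=> //; have [p_inj p_edge] := hp.
have T8 : #|T| = 8 by rewrite cardT n4.
apply: (Gamma_alternating e_sym T8 p_inj) => [i j iT jT|i j iT jT ij].
  by apply: e_par; rewrite // n4.
have non_full a b c : a < 8 -> b < 8 -> odd a != odd b -> ~~ h (p a) (p b) ->
    e (p a) (p c) = h (p a) (p c).
  by move=> aT bT oab; apply: e_eq; apply: opp; rewrite ?n4.
have adjS4 a b : a < 4 -> b < 4 -> ~~ odd a ->
    h (p a.*2) (p b.*2.+1) = ~~ odd (if b < a then b.+1 else b).
  by move=> aT bT ea; rewrite adjS ?alt ?n4 //; case: ifP; lia.
have adjN4 a b : a < 4 -> b < 4 -> odd a ->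
    h (p a.*2.+1) (p b.*2) = odd (if a < b then b.-1 else b).
  by move=> aT bT oa; rewrite adjN ?alt ?n4 ?negbK //; case: ifP; lia.
have [oi|ei] := boolP (odd i); last first.
  rewrite (non_full _ 7) ?(adjS4 i) ?(adjS4 i 3) //; try lia.
    by move: i j iT jT ei {ij} => [|[|[|[|i]]]] // [|[|[|[|j]]]].
  by case: ifP; lia.
have [oj|ej] := boolP (odd j).
  rewrite e_sym (non_full _ 0) ?(adjN4 j) ?(adjN4 j 0) //; try lia.
  by move: i j iT jT oi oj {ij} => [|[|[|[|i]]]] // [|[|[|[|j]]]].
(* The pairs left are [x_1 y_0] and [x_3 y_2], which are path edges, and [x_3 y_0], excluded by
   [alternating4_nonadj61]. *)
have n61 : ~~ h (p 6) (p 1).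
  exact: (alternating4_nonadj61 h_sym h_opp cardT n_ge2 h_nonham deg_sum hp n4
    alt).
have edge l : l < 7 -> h (p l) (p l.+1) by move=> lT; apply: p_edge; rewrite T8.
move: i j iT jT oi ej ij => [|[|[|[|i]]]] [|[|[|[|j]]]] // _ _ _ _ _.
- rewrite e_sym (non_full 1 4) //; first by rewrite (edge 1).
  by rewrite h_sym (adjS4 2 0).
- rewrite (non_full 6 3) ?(negbTE n61) //.
  by rewrite h_sym (adjN4 1 3).
- rewrite (non_full 6 3) //; first by rewrite h_sym (edge 5).
  by rewrite h_sym (adjN4 1 3).
Qed.

Local Open Scope ring_scope.

Theorem theorem1p11 (R : realType) (n : nat) (n_ge2 : (2 <= n)%N)
    (T : finType) (e : rel T) (X Y : {set T})
    (e_simple : simple_graph e) (e_bip : has_partite_sets e X Y)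
    (cardX : #|X| = n) (cardY : #|Y| = n)
    (q : R) (q_radius : signless_radius (quasi_complement X Y e) q)
    (q_le : (q <= n%:R)%R) :
  [\/ hamiltonian e,
      exists2 k : nat, (1 <= k <= n./2)%N & in_B n k e
    | n = 4%N /\ (graph_iso e Gamma1 \/ graph_iso e Gamma2)].
Proof.
have [e_ham|e_nonham] := boolp.pselect (hamiltonian e); first by constructor 1.
have [e_sym _] := e_simple.
have [h [[h_sym eh h_opp] h_nonham [p hp] deg_sum e_eq]] :=
  tight_nonhamiltonian_extension n_ge2 e_sym e_bip cardX cardY q_radius q_le
    e_nonham.
have cardT : #|T| = n.*2 by rewrite (card_bipartite e_bip) cardX cardY addnn.
have := tight_nonhamiltonian_exceptional n_ge2 cardT e_sym h_sym eh h_opp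
  h_nonham deg_sum e_eq hp.
by case; [constructor 2 | constructor 3].
Qed.
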